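(* Let $F$ be a field, let $k\ge 1$, and let $d_1,\ldots,d_k,x_1,\ldots,x_k$ be independent commuting indeterminates over $F$. For $j\ge 1$ put $p_j=d_1x_1^j+\cdots+d_kx_k^j$, and let $X=\mathrm{diag}(x_1,\ldots,x_k)$. Then there exist an integer $n\ge 1$, a nonzero polynomial $\alpha_n\in F[d_1,\ldots,d_k]$, and polynomials $\alpha_\lambda\in F[d_1,\ldots,d_k]$, one for each partition $\lambda$ with $1\le|\lambda|\le n$, such that $$\alpha_n X^n=\sum_{1\le|\lambda|\le n}\alpha_\lambda\, p_\lambda\, X^{n-|\lambda|}$$ as $k\times k$ diagonal matrices over $F[d_1,\ldots,d_k,x_1,\ldots,x_k]$.
   Context: For a partition $\lambda=(\lambda_1,\lambda_2,\ldots,\lambda_a)$ with positive parts, $p_\lambda=p_{\lambda_1}p_{\lambda_2}\cdots p_{\lambda_a}$ and $|\lambda|=\lambda_1+\cdots+\lambda_a$. $X^0$ is the identity matrix. Elements of $F[d_1,\ldots,d_k,x_1,\ldots,x_k]$ act on diagonal matrices by scalar multiplication. *)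

(* Defs.v *)
From mathcomp Require Export all_boot all_order all_algebra.
From mathcomp Require Export mpoly.

Set Implicit Arguments.
Unset Strict Implicit.
Unset Printing Implicit Defensive.

Import GRing.Theory.
Local Open Scope ring_scope.

(* A partition is the weakly decreasing sequence of its parts, all positive;
   its size |l| is [sumn l]. *)
Definition is_partition (l : seq nat) : bool := sorted geq l && (0 \notin l)%N.

(* The partitions l with 1 <= |l| <= n, each listed once.  Such an l has at
   most n parts, each of them at most n, so it occurs among the sequences of
   type n.-bseq 'I_n.+1; see [mem_partitions] and [uniq_partitions]. *)
Definition partitions (n : nat) : seq (seq nat) :=
  [seq l <- [seq map val (bs : seq 'I_n.+1) | bs : n.-bseq 'I_n.+1]
     | is_partition l && (1 <= sumn l <= n)%N].

Lemma mem_partitions n l :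
  (l \in partitions n) = is_partition l && (1 <= sumn l <= n)%N.
Proof.
rewrite mem_filter; apply: andb_idr => /andP[/andP[_ l_pos] /andP[_ l_le]].
have size_l : (size l <= sumn l)%N.
  elim: l l_pos {l_le} => //= m l IHl.
  rewrite inE negb_or eq_sym => /andP[m_neq0 /IHl].
  by rewrite -add1n => /(leq_add _)-> //; rewrite lt0n.
have part_le m : m \in l -> (m < n.+1)%N.
  move=> l_m; rewrite ltnS; apply: leq_trans l_le.
  by rewrite sumnE (big_rem m) //= leq_addr.
have size_s : (size (map (@inord n) l) <= n)%N.
  by rewrite size_map (leq_trans size_l).
apply/mapP; exists (Bseq size_s); first by rewrite mem_enum.
rewrite /= -map_comp -[LHS]map_id; apply/eq_in_map => m l_m /=.
by rewrite inordK ?part_le.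
Qed.

Lemma uniq_partitions n : uniq (partitions n).
Proof.
apply/filter_uniq; rewrite map_inj_uniq ?enum_uniq // => s t.
by move/(inj_map val_inj)/val_inj.
Qed.

Section PowerSums.
Variables (F : fieldType) (k : nat).

(* F[d_1, ..., d_k, x_1, ..., x_k] is {mpoly F[k + k]}: the first k variables
   are the d_i, the last k are the x_i. *)
Definition dvar (i : 'I_k) : {mpoly F[k + k]} := 'X_(lshift k i).
Definition xvar (i : 'I_k) : {mpoly F[k + k]} := 'X_(rshift k i).

(* The inclusion of F[d_1, ..., d_k] into F[d_1, ..., d_k, x_1, ..., x_k]. *)
Definition dpoly (a : {mpoly F[k]}) : {mpoly F[k + k]} :=
  a \mPo [tuple dvar i | i < k].

Definition powsum (j : nat) : {mpoly F[k + k]} :=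
  \sum_(i < k) dvar i * xvar i ^+ j.

Definition powsum_part (l : seq nat) : {mpoly F[k + k]} :=
  \prod_(j <- l) powsum j.

Definition Xmx : 'M[{mpoly F[k + k]}]_k := diag_mx (\row_i xvar i).

End PowerSums.

Arguments powsum_part : clear implicits.
Arguments Xmx : clear implicits.

(* Main.v *)
From HB Require Import structures.
Require Import Defs.
From mathcomp Require Import ring.

(** The relation says that one homogeneous monic equation, with coefficients in
    the algebra A generated over the field K = F(d_1, ..., d_k) by the power
    sums, is satisfied by all of x_1, ..., x_k.  The point is thus that
    K[x_1, ..., x_k] is integral over the graded algebra A.  By the graded
    Nakayama lemma this follows once the p_j with 1 <= j <= k have no common
    zero other than the origin.  They have none: grouping the coordinates
    of a common zero by their nonzero values, a Vandermonde determinant shows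
    that the sum of the d_i over each group is 0, while sums of distinct
    indeterminates are not 0.

    In place of the Nullstellensatz, [radical_powsum] runs this argument
    modulo an ideal, by an induction that merges coordinates, and yields
    directly that a power of each x_i lies in the ideal generated by the p_j.
    Consequently the monomials of bounded degree span K[x_1, ..., x_k] as an
    A-module ([spannedT]), and the Cayley-Hamilton theorem gives a monic
    polynomial Q over A that vanishes at every x_i ([var_integral]).  If n is
    the degree of Q, the component of degree n of Q(x_i) = 0 is the desired
    relation over K ([homogeneous_integral_relation]), because the
    component of degree j of an element of A is a combination of the p_l with
    |l| = j.  Clearing the denominators of its finitely many coefficients
    produces the factor alpha_n. *)

Set Implicit Arguments.
Unset Strict Implicit.
Unset Printing Implicit Defensive.

Import GRing.Theory.
Local Open Scope ring_scope.

(** * Radicals of ideals *)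

Section Ideals.
Variable R : comNzRingType.
Implicit Types (I : R -> Prop) (a b f z : R).

Record is_ideal I : Prop := IsIdeal {
  ideal0 : I 0;
  idealD : forall a b, I a -> I b -> I (a + b);
  idealM : forall f a, I a -> I (f * a) }.

Definition adjoin I a : R -> Prop := fun f => exists r, I (f - r * a).

Lemma ideal_sum I (T : eqType) (s : seq T) (E : T -> R) :
  is_ideal I -> (forall x, x \in s -> I (E x)) -> I (\sum_(x <- s) E x).
Proof.
move=> idI IE; rewrite big_seq.
by elim/big_ind: _ => //; [apply: ideal0 | apply: idealD].
Qed.

Lemma adjoin_ideal I a : is_ideal I -> is_ideal (adjoin I a).
Proof.
move=> idI; split.
- by exists 0; rewrite mul0r subr0; apply: ideal0.
- move=> f g [r If] [s Ig]; exists (r + s).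
  by rewrite mulrDl opprD addrACA; apply: idealD.
- by move=> h f [r If]; exists (h * r); rewrite -mulrA -mulrBr; apply: idealM.
Qed.

Lemma adjoin_sub I a f : is_ideal I -> I f -> adjoin I a f.
Proof. by move=> idI If; exists 0; rewrite mul0r subr0. Qed.

(** An element of both rad(I + a) and rad(I + b) is in rad(I + ab): if
    [z ^+ M - q * a] and [z ^+ N - r * b] lie in [I], then so does
    [z ^+ (M + N) - q * r * (a * b)].  This replaces the reduction to prime
    ideals, and lets a product in [I] be treated one factor at a time. *)
Lemma radical_prod I z (s : seq R) :
    is_ideal I -> (forall a, a \in s -> exists N, adjoin I a (z ^+ N)) ->
  I (\prod_(a <- s) a) -> exists N, I (z ^+ N).
Proof.
move=> idI rad_s Is.
suff [N [r Ir]]: exists N, adjoin I (\prod_(a <- s) a) (z ^+ N).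
  exists N; rewrite -[_ ^+ N](subrK (r * \prod_(a <- s) a)).
  by apply: idealD => //; apply: idealM.
elim: s rad_s {Is} => [|a s IHs] rad_s.
  by exists 0, 1; rewrite big_nil expr0 mulr1 subrr; apply: ideal0.
have [b s_b|N [r Ir]] := IHs; first by apply: rad_s; rewrite inE s_b orbT.
have [|M [q Iq]] := rad_s a; first by rewrite inE eqxx.
exists (M + N)%N, (q * r); rewrite big_cons exprD.
set b := \prod_(_ <- s) _ in Ir *.
have ->: z ^+ M * z ^+ N - q * r * (a * b)
    = z ^+ N * (z ^+ M - q * a) + q * a * (z ^+ N - r * b) by ring.
by apply: idealD => //; apply: idealM.
Qed.

End Ideals.

(** * Common zeros of weighted power sums *)

(** A point of the system is a pair [(A, a)]: a value [a] carrying the total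
    weight of a list [A] of indices.  Keeping the indices rather than the
    weight lets points with equal values be merged by concatenation, while the
    hypothesis on subset sums remains usable as long as no index repeats. *)
Section WeightedPowerSums.
Variables (K : fieldType) (R : comAlgType K) (T : eqType) (w : T -> K).
Hypothesis w_neq0 : forall A : seq T, uniq A -> A != [::] ->
  \sum_(i <- A) w i != 0.
Implicit Types (s : seq (seq T * R)).

Definition weight (A : seq T) : K := \sum_(i <- A) w i.

Definition wpowsum s j : R := \sum_(p <- s) weight p.1 *: p.2 ^+ j.

(** Apply the functional sending [g] to the weighted sum of its values to
    the polynomial X * prod (X - b), [b] ranging over the points other than
    [a].  It has no constant term, so the result combines power sums of positive
    exponent; it vanishes at every point but [a], so the result is also a
    nonzero scalar times the displayed product. *)
Lemma ideal_Vandermonde (I : R -> Prop) A a s :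
    is_ideal I -> weight A != 0 ->
    (forall j, (1 <= j <= (size s).+1)%N -> I (wpowsum ((A, a) :: s) j)) ->
  I (a * \prod_(p <- s) (a - p.2)).
Proof.
move=> idI wA_neq0 Ips.
pose g : {poly R} := 'X * \prod_(p <- s) ('X - p.2%:P).
have gE x : g.[x] = x * \prod_(p <- s) (x - p.2).
  rewrite hornerM hornerX horner_prod; congr (_ * _).
  by apply: eq_bigr => p _; rewrite hornerXsubC.
have g0 : g`_0 = 0 by rewrite coefXM.
have size_g : size g = (size s).+2.
  rewrite /g mulrC size_mulX ?size_prod_XsubC //.
  by apply: monic_neq0; apply: monic_prod_XsubC.
rewrite -gE.
have -> : g.[a] = (weight A)^-1 *:
    \sum_(p <- (A, a) :: s) weight p.1 *: g.[p.2].
  rewrite big_cons big_seq big1 ?addr0 ?scalerA ?mulVf ?scale1r // => p s_p.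
  by rewrite gE (big_rem p) //= subrr mul0r mulr0 scaler0.
rewrite -[\sum_(_ <- _) _]mul1r scalerAl; apply: idealM => //.
have -> : \sum_(p <- (A, a) :: s) weight p.1 *: g.[p.2]
    = \sum_(j <- iota 0 (size g)) g`_j * wpowsum ((A, a) :: s) j.
  under eq_bigr do rewrite horner_coef scaler_sumr.
  rewrite exchange_big /= -val_enum_ord big_map big_enum /=.
  apply: eq_bigr => j _; rewrite mulr_sumr; apply: eq_bigr => p _.
  by rewrite scalerAr.
apply: ideal_sum => // -[|j]; rewrite mem_iota size_g => j_lt.
  by rewrite g0 mul0r; apply: ideal0.
by apply: idealM => //; apply: Ips.
Qed.

(** A common zero of the power sums has all its coordinates zero, in the form
    valid modulo an ideal.  By [ideal_Vandermonde] the ideal contains the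
    product of [a] and of the differences [a - b], so by [radical_prod] it
    is enough to adjoin one of these factors.  Adjoining [a] discards the
    point [(A, a)]; adjoining [a - b] merges [(A, a)] and [(B, b)].  Both
    leave fewer points.  The element [z] is only required to be
    congruent to a point, or to 0, because the point itself may be
    discarded or merged along the way. *)
Lemma radical_powsum n s (I : R -> Prop) z :
    size s = n -> is_ideal I ->
    uniq (flatten (map fst s)) -> all (fun p => p.1 != [::]) s ->
    (forall j, (1 <= j <= n)%N -> I (wpowsum s j)) ->
    I z \/ (exists2 p, p \in s & I (z - p.2)) ->
  exists N, I (z ^+ N).
Proof.
elim: n s I => [|n IHn] [|[A a] s] //= I.
  by move=> _ _ _ _ _ [Iz | [p]] //; exists 1%N.
move=> [size_s] idI uniqs /andP[A_neq0 all_s] Ips Iz.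
have Iu : I (a * \prod_(p <- s) (a - p.2)).
  apply: (ideal_Vandermonde (A := A)) => //; last by rewrite size_s.
  by apply: w_neq0 => //; move: uniqs; rewrite cat_uniq => /andP[].
have {}Iz : I z \/ I (z - a) \/ exists2 p, p \in s & I (z - p.2).
  case: Iz => [|[p]]; first by left.
  rewrite inE => /orP[/eqP-> | s_p] Ip; first by right; left.
  by right; right; exists p.
apply: (@radical_prod _ I z (a :: [seq a - p.2 | p <- s])) => //; last first.
  by rewrite big_cons big_map.
move=> c; rewrite inE => /orP[/eqP-> | /mapP[[B b] s_b ->]] {c} /=.
  have idIa := adjoin_ideal a idI.
  apply: (IHn s) => //.
  - by move: uniqs; rewrite cat_uniq => /and3P[].
  - move=> j /andP[j_gt0 j_le]; exists (- (weight A *: a ^+ j.-1)).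
    rewrite mulNr opprK -scalerAl -exprSr prednK //.
    have := Ips j; rewrite /wpowsum big_cons /= addrC; apply.
    by rewrite j_gt0 ltnW.
  - case: Iz => [Iz | [Iz | [p s_p Ip]]].
    + by left; apply: adjoin_sub.
    + by left; exists 1; rewrite mul1r.
    + by right; exists p => //; apply: adjoin_sub.
case/splitPr: s_b size_s uniqs all_s Ips Iz {Iu} => s1 s2 size_s uniqs.
rewrite all_cat /= => /and3P[all_s1 B_neq0 all_s2] Ips Iz.
have idIab := adjoin_ideal (a - b) idI.
apply: (IHn ((A ++ B, a) :: s1 ++ s2)) => //.
- by move: size_s; rewrite /= !size_cat /= addnS.
- rewrite (perm_uniq (s2 := flatten (map fst ((A, a) :: s1 ++ (B, b) :: s2))))
    //= !map_cat !flatten_cat /= -catA perm_cat2l.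
  by rewrite perm_catCA.
- rewrite /= all_cat all_s1 all_s2 -size_eq0 size_cat addn_eq0 size_eq0.
  by rewrite (negPf A_neq0).
- move=> j /andP[j_gt0 j_le].
  have := Ips j; rewrite j_gt0 leqW // /wpowsum => /(_ isT).
  rewrite !big_cons !big_cat /= big_cons /= => Ij.
  (* the power sums before and after the merge differ by
     weight B *: (a ^+ j - b ^+ j) *)
  exists (weight B *: (\sum_(i < j) a ^+ (j.-1 - i) * b ^+ i)).
  rewrite -scalerAl mulrC -subrXX.
  rewrite /weight big_cat /= -!/(weight _).
  move: Ij; congr (I _); rewrite scalerBr scalerDl.
  set u := _ *: a ^+ j; set v := _ *: a ^+ j; set t := _ *: b ^+ j.
  by ring.
- case: Iz => [Iz | [Iz | [p s_p Ip]]].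
  + by left; apply: adjoin_sub.
  + by right; exists (A ++ B, a); rewrite ?inE ?eqxx //; apply: adjoin_sub.
  + right; move: s_p; rewrite mem_cat inE orbCA.
    case/orP=> [/eqP pE | s_p]; last first.
      by exists p; rewrite ?inE ?mem_cat ?s_p ?orbT //; apply: adjoin_sub.
    exists (A ++ B, a); rewrite ?inE ?eqxx //; exists (-1) => /=.
    move: Ip; rewrite pE /=; congr (I _); ring.
Qed.

End WeightedPowerSums.

(** * Integrality over the algebra of power sums *)

(** Cayley-Hamilton: the matrix of multiplication by [x] on a finite spanning
    family has a characteristic polynomial that, evaluated at [x],
    annihilates the whole family, in particular its member 1. *)
Lemma monic_root_of_finite_module (A R : comNzRingType)
    (phi : {rmorphism A -> R}) (T : finType) (v : T -> R) (b0 : T) (x : R) :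
    v b0 = 1 ->
    (forall b, exists M : T -> A, x * v b = \sum_c phi (M c) * v c) ->
  exists2 Q : {poly A}, Q \is monic & root (map_poly phi Q) x.
Proof.
move=> vb0 /fin_all_exists[M xvE].
pose MT : 'M[A]_#|T| := \matrix_(i, j) M (enum_val i) (enum_val j).
pose V : 'cV[R]_#|T| := \col_i v (enum_val i).
have ev_mx : map_mx (fun p : {poly R} => p.[x]) (char_poly_mx (map_mx phi MT))
    = x%:M - map_mx phi MT.
  apply/matrixP => i j.
  by rewrite !mxE hornerD hornerN hornerC hornerMn hornerX.
have VK : (x%:M - map_mx phi MT) *m V = 0.
  apply/eqP; rewrite mulmxBl subr_eq0 mul_scalar_mx; apply/eqP/matrixP => i j.
  rewrite !mxE xvE (reindex _ (onW_bij _ (@enum_val_bij T))) /=.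
  by apply: eq_bigr => c _; rewrite !mxE.
exists (char_poly MT); first exact: char_poly_monic.
have := congr1 (mulmx (\adj (x%:M - map_mx phi MT))) VK.
rewrite mulmxA mul_adj_mx mulmx0 mul_scalar_mx => /matrixP.
move=> /(_ (enum_rank b0) 0).
rewrite !mxE enum_rankK vb0 mulr1 => det0.
by rewrite /root map_char_poly /char_poly -[_.[x]]/(horner_eval x _) -det_map_mx
  ev_mx det0.
Qed.

Section PowerSumSubalgebra.
Variables (K : fieldType) (k : nat) (w : 'I_k -> K).
Hypothesis w_neq0 : forall A : seq 'I_k, uniq A -> A != [::] ->
  \sum_(i <- A) w i != 0.

Local Notation R := {mpoly K[k]}.

Definition psum j : R := \sum_(i < k) w i *: 'X_i ^+ j.

(** The image of this substitution is the subalgebra generated by the first [k]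
    power sums.  Giving the subalgebra as the image of a morphism makes its
    elements explicit combinations of products of power sums. *)
Definition psubst (h : R) : R := h \mPo [tuple psum i.+1 | i < k].

HB.instance Definition _ := GRing.RMorphism.copy psubst
  (comp_mpoly [tuple psum i.+1 | i < k]).

Lemma psubstX m : psubst 'X_[m] = \prod_(i < k) psum i.+1 ^+ m i.
Proof.
by rewrite /psubst comp_mpolyX; apply: eq_bigr => i _; rewrite tnth_mktuple.
Qed.

Lemma psubstU i : psubst 'X_i = psum i.+1.
Proof. by rewrite /psubst comp_mpolyXU -tnth_nth tnth_mktuple. Qed.

Lemma psubstZ c h : psubst (c *: h) = c *: psubst h.
Proof. exact: comp_mpolyZ. Qed.

Lemma varX_homog i j : ('X_i ^+ j : R) \is j.-homog.
Proof. by rewrite mpolyXn dhomogX /= mdegMn mdeg1 mul1n. Qed.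

Lemma psum_homog j : psum j \is j.-homog.
Proof.
by apply: rpred_sum => i _; apply: rpredZ; apply: varX_homog.
Qed.

Lemma pihomogM d e (f g : R) : g \is e.-homog ->
  pihomog mdeg d (f * g) =
  if (e <= d)%N then pihomog mdeg (d - e) f * g else 0.
Proof.
move=> hom_g; rewrite {1}(mpolyE f) mulr_suml linear_sum /=.
under eq_bigr => m _.
  rewrite -scalerAl linearZ /=.
  have hom_mg : 'X_[m] * g \is (mdeg m + e).-homog.
    by apply: dhomogM; rewrite // dhomogX.
  have -> : pihomog mdeg d ('X_[m] * g) =
     if (mdeg m + e == d)%N then 'X_[m] * g else 0.
    case: eqP => [<- | /eqP ne]; first by rewrite pihomog_dE.
    by rewrite (pihomog_ne0 ne).
  over.
case: leqP => [le_ed | lt_de]; last first.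
  rewrite big1 // => m _.
  by rewrite gtn_eqF ?scaler0 // (leq_trans lt_de) ?leq_addl.
rewrite pihomogE mulr_suml big_mkcond [RHS]big_mkcond /=.
rewrite [RHS]big_mkcond /=; apply: eq_bigr => m _.
rewrite -[in RHS](eqn_add2r e) subnK //; case: eqP => _.
  by rewrite scalerAl.
by rewrite scaler0.
Qed.

(** Graded form of [radical_powsum]: the cofactors may be truncated to the
    degree that makes the relation homogeneous.  That they then have
    degree less than [N] is what makes the induction in [spannedT]
    decrease. *)
Lemma var_pow_psum_ideal : exists N, forall i, exists2 g : 'I_k -> R,
  'X_i ^+ N = \sum_(j < k) g j * psum j.+1 &
  forall j m, m \in msupp (g j) -> (mdeg m < N)%N.
Proof.
pose I (f : R) := exists g : 'I_k -> R, f = \sum_(j < k) g j * psum j.+1.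
have idI : is_ideal I.
  split=> [|_ _ [g ->] [h ->]|f _ [g ->]].
  - by exists (fun _ => 0); rewrite big1 // => j _; rewrite mul0r.
  - exists (fun j => g j + h j); rewrite -big_split /=.
    by apply: eq_bigr => j _; rewrite mulrDl.
  - exists (fun j => f * g j); rewrite mulr_sumr.
    by apply: eq_bigr => j _; rewrite mulrA.
have /fin_all_exists[N IN] : forall i : 'I_k, exists N, I ('X_i ^+ N).
  move=> i; pose s := [seq ([:: j], 'X_j : R) | j <- enum 'I_k].
  apply: (radical_powsum w_neq0 (s := s) (n := k)) => //.
  - by rewrite size_map size_enum_ord.
  - rewrite /s -map_comp (@eq_map _ _ _ (fun j => [:: j])) //.
    by rewrite flatten_map1 map_id enum_uniq.
  - by apply/allP => _ /mapP[j _ ->].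
  - move=> j /andP[j_gt0 j_le]; rewrite /wpowsum big_map big_enum /=.
    have ltj : (j.-1 < k)%N by rewrite prednK.
    exists (fun l => (l == Ordinal ltj)%:R).
    rewrite [RHS](bigD1 (Ordinal ltj)) //= eqxx mul1r.
    rewrite [X in _ + X]big1 ?addr0 => [|l /negPf->].
      rewrite prednK // /psum; apply: eq_bigr => l _.
      by rewrite /weight big_seq1.
    by rewrite mul0r.
  - right; exists ([:: i], 'X_i); last by rewrite subrr; apply: ideal0.
    by apply/mapP; exists i; rewrite ?mem_enum.
(* any common upper bound of the exponents N i would do *)
pose M := (\sum_i N i)%N; exists M => i.
have [g /(congr1 (pihomog mdeg M))] : I ('X_i ^+ M).
  rewrite -[M](@subnK (N i)) ?exprD; first exact: idealM.
  by rewrite /M (bigD1 i) //= leq_addr.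
rewrite pihomog_dE ?varX_homog //.
rewrite linear_sum /= => ->.
exists (fun j : 'I_k =>
  if (j < M)%N then pihomog mdeg (M - j.+1) (g j) else 0).
  apply: eq_bigr => j _; rewrite (pihomogM _ _ (psum_homog _)).
  by case: ifP; rewrite ?mul0r.
move=> j m; case: ifP => lt_jM; last by rewrite msupp0.
move/(dhomog_mf (pihomogP _ _ _)) => /= ->.
by rewrite ltn_subrL (leq_trans _ lt_jM).
Qed.

Definition spanned B (f : R) : Prop := exists h : 'X_{1..k < B} -> R,
  f = \sum_b psubst (h b) * 'X_[b].

Lemma spanned_sum B (T : eqType) (s : seq T) (E F : T -> R) :
  (forall t, t \in s -> spanned B (F t)) ->
  spanned B (\sum_(t <- s) psubst (E t) * F t).
Proof.
elim: s => [|t s IHs] sF.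
  exists (fun _ => 0); rewrite big_nil big1 // => b _.
  by rewrite rmorph0 mul0r.
have [h FE] := sF t (mem_head _ _).
have [u s_u|g sE] := IHs; first by apply: sF; rewrite inE s_u orbT.
exists (fun b => E t * h b + g b).
rewrite big_cons sE FE mulr_sumr -big_split /=; apply: eq_bigr => b _.
by rewrite rmorphD rmorphM /=; ring.
Qed.

Lemma spanned_comb B (f : R) :
  (forall m, m \in msupp f -> spanned B 'X_[m]) -> spanned B f.
Proof.
move=> sX; rewrite (mpolyE f).
have := spanned_sum (fun m => (f@_m)%:MP) sX; congr (spanned B _).
apply: eq_bigr => m _.
by rewrite -mul_mpolyC; congr (_ * _); apply: comp_mpolyC.
Qed.

(** Graded Nakayama.  A monomial of degree greater than [k * N] has an
    exponent that is at least [N]; [var_pow_psum_ideal] then rewrites it as a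
    combination, with power sums as coefficients, of monomials of smaller
    degree. *)
Lemma spannedT : exists B, (0 < B)%N /\ forall f, spanned B f.
Proof.
have [N powE] := var_pow_psum_ideal.
exists (k * N).+1; split=> // f; apply: spanned_comb => m _.
elim/ltn_ind: {m}(mdeg m) {-2}m (erefl (mdeg m)) => d IHd m deg_m.
case: (ltnP d (k * N).+1) => [lt_dB | le_Bd].
  rewrite -deg_m in lt_dB.
  exists (fun b => (b == BMultinom lt_dB)%:R).
  rewrite (bigD1 (BMultinom lt_dB)) //= eqxx rmorph1 mul1r.
  by rewrite big1 ?addr0 // => b /negPf->; rewrite rmorph0 mul0r.
have /existsP[i le_Nm] : [exists i : 'I_k, (N <= m i)%N].
  rewrite -[[exists _, _]]negbK negb_exists; apply/negP => /forallP m_lt.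
  move: le_Bd; rewrite ltnNge -deg_m mdegE => /negP[].
  rewrite -[k in (k * N)%N]card_ord -sum_nat_const; apply: leq_sum => i _.
  by have := m_lt i; rewrite -ltnNge => /ltnW.
pose m' := (m - U_(i) *+ N)%MM.
have mE : m = (m' + U_(i) *+ N)%MM.
  rewrite submK //; apply/mnm_lepP => j.
  by rewrite mulmnE mnm1E; case: eqP => [<-|_]; rewrite ?mul1n ?mul0n.
have [g XE g_lt] := powE i.
have -> : 'X_[m] = \sum_(j <- enum 'I_k) psubst 'X_j * (g j * 'X_[m']).
  rewrite mE mpolyXD -mpolyXn XE mulr_sumr big_enum /=.
  by apply: eq_bigr => j _; rewrite psubstU; ring.
apply: spanned_sum => j _; apply: spanned_comb => m2.
move/msuppM_le/allpairsP=> [[m3 m4] /= [m3_g]].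
rewrite msuppX inE => /eqP-> ->; apply: (IHd _ _ _ erefl).
by rewrite -deg_m mE !mdegD addnC ltn_add2l mdegMn mdeg1 mul1n (g_lt j).
Qed.

(** One polynomial for all the variables: the product of those given by
    [monic_root_of_finite_module]. *)
Lemma var_integral : exists2 Q : {poly R}, Q \is monic &
  forall i : 'I_k, root (map_poly psubst Q) 'X_i.
Proof.
have [B [B_gt0 spanB]] := spannedT.
have /fin_all_exists2[Q Qmonic Qroot] : forall i : 'I_k,
    exists2 Q : {poly R}, Q \is monic & root (map_poly psubst Q) 'X_i.
  move=> i; have lt0B : (mdeg (0 : 'X_{1..k})%MM < B)%N by rewrite mdeg0.
  apply: (@monic_root_of_finite_module _ _ _ _
    (fun b : 'X_{1..k < B} => 'X_[b]) (BMultinom lt0B)).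
    by rewrite /= mpolyX0.
  by move=> b; apply: spanB.
exists (\prod_i Q i); first by apply: monic_prod.
by move=> i; rewrite (bigD1 i) //= rmorphM /= rootM Qroot.
Qed.

End PowerSumSubalgebra.

(** * The homogeneous relation over a field *)

Section MonomialParts.
Variable k : nat.
Implicit Types m : 'X_{1..k}.

(** The i-th variable of [psubst] stands for the power sum of exponent
    [i.+1], so a monomial [m] stands for the partition in which [i.+1] is
    repeated [m i] times. *)
Definition mparts m : seq nat :=
  sort geq (flatten [seq nseq (m i) (nat_of_ord i).+1 | i <- enum 'I_k]).

Lemma mparts_partition m : is_partition (mparts m).
Proof.
rewrite /is_partition sort_sorted; last by move=> x y; apply: leq_total.
rewrite mem_sort; apply/flattenP => -[_ /mapP[i _ ->]].
by rewrite mem_nseq andbF.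
Qed.

Lemma big_mparts (S : Type) (x0 : S) (op : Monoid.com_law x0) (E : nat -> S) m :
  \big[op/x0]_(j <- mparts m) E j =
  \big[op/x0]_(i < k) iterop (m i) op (E i.+1) x0.
Proof.
rewrite (perm_big _ (permEl (perm_sort _ _))) big_flatten big_map big_enum /=.
by apply: eq_bigr => i _; rewrite big_nseq Monoid.iteropE.
Qed.

End MonomialParts.

Section OverField.
Variables (K : fieldType) (k : nat) (w : 'I_k -> K).
Local Notation R := {mpoly K[k]}.

Definition psum_part (l : seq nat) : R := \prod_(j <- l) psum w j.

Lemma psum_part_mparts m : psum_part (mparts m) = psubst w 'X_[m].
Proof. by rewrite psubstX /psum_part big_mparts. Qed.

Lemma psum_part_homog l : psum_part l \is (sumn l).-homog.
Proof.
rewrite /psum_part; elim: l => [|j l IHl]; first by rewrite big_nil dhomog1.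
by rewrite big_cons; apply: dhomogM => //; apply: psum_homog.
Qed.

Definition part_coef (h : R) (l : seq nat) : K :=
  \sum_(m <- msupp h | mparts m == l) h@_m.

Lemma pihomog_psubst n j h : (1 <= j <= n)%N ->
  pihomog mdeg j (psubst w h) =
  \sum_(l <- partitions n | sumn l == j) part_coef h l *: psum_part l.
Proof.
move=> j_bd; rewrite {1}(mpolyE h) rmorph_sum linear_sum /=.
under [RHS]eq_bigr => l _ do rewrite /part_coef scaler_suml.
rewrite (exchange_big_dep xpredT) //=; apply: eq_bigr => m _.
rewrite psubstZ linearZ /= -psum_part_mparts.
have [deg_j | deg_j] := eqVneq (sumn (mparts m)) j; last first.
  rewrite (pihomog_ne0 deg_j (psum_part_homog _)) scaler0 big_pred0 // => l.
  by apply/andP => -[/eqP lj /eqP lE]; rewrite lE lj eqxx in deg_j.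
rewrite pihomog_dE -?{1}deg_j ?psum_part_homog //.
have part_m : mparts m \in partitions n.
  by rewrite mem_partitions mparts_partition deg_j.
rewrite big_mkcond (bigD1_seq (mparts m)) ?uniq_partitions //= deg_j !eqxx /=.
by rewrite big1 ?addr0 // => l; rewrite eq_sym => /negPf->; rewrite andbF.
Qed.

Hypothesis w_neq0 : forall A : seq 'I_k, uniq A -> A != [::] ->
  \sum_(i <- A) w i != 0.

(** Take the component of degree [n] of the equation given by
    [var_integral], [n] being its degree: the leading term is left untouched,
    and each other coefficient is replaced by its homogeneous component of
    positive degree, a combination of products of power sums over the
    partitions of that degree. *)
Lemma homogeneous_integral_relation :
  exists (n : nat) (alpha : seq nat -> K), (1 <= n)%N /\
    forall i : 'I_k, 'X_i ^+ n = \sum_(l <- partitions n)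
      alpha l *: (psum_part l * 'X_i ^+ (n - sumn l)) :> R.
Proof.
have [Q0 Q0monic Q0root] := var_integral w_neq0.
(* the factor 'X serves only to make the degree n positive *)
pose Q := Q0 * 'X; pose n := (size Q).-1.
have Qmonic : Q \is monic by rewrite monicMl ?monicX.
have size_Q : size Q = n.+1 by rewrite prednK // size_poly_gt0 monic_neq0.
have n_gt0 : (0 < n)%N.
  by rewrite /n size_mulX ?monic_neq0 //= size_poly_gt0 monic_neq0.
have Qn : Q`_n = 1 by move/monicP: Qmonic; rewrite lead_coefE size_Q.
exists n, (fun l => - part_coef Q`_(n - sumn l) l); split=> // i.
have Qroot : \sum_(j < n.+1) psubst w Q`_j * 'X_i ^+ j = 0.
  have : (map_poly (psubst w) Q).[ 'X_i ] = 0.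
    by rewrite rmorphM /= hornerM (rootP (Q0root i)) mul0r.
  rewrite (@horner_coef_wide _ (size Q) (map_poly (psubst w) Q)) ?size_poly //.
  by rewrite size_Q; under eq_bigr do rewrite coef_map.
move/(congr1 (pihomog mdeg n))/eqP: Qroot.
rewrite raddf0 big_ord_recr /= Qn rmorph1 mul1r raddfD /=.
rewrite [pihomog _ _ ('X_i ^+ n)]pihomog_dE ?varX_homog // addrC addr_eq0.
move/eqP->; rewrite [pihomog _ _ _]linear_sum -sumrN /=.
(* group the partitions by size, j being the exponent left to 'X_i *)
transitivity (\sum_(j < n) \sum_(l <- partitions n | sumn l == (n - j)%N)
    - part_coef Q`_(n - sumn l) l *: (psum_part l * 'X_i ^+ (n - sumn l))).
  apply: eq_bigr => j _; have lt_jn := ltn_ord j.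
  rewrite (pihomogM _ _ (varX_homog _ _ _)) ltnW //.
  rewrite (@pihomog_psubst n) ?subn_gt0 ?lt_jn ?leq_subr // mulr_suml -sumrN.
  apply: eq_bigr => l /eqP->.
  by rewrite subKn ?(ltnW lt_jn) // scaleNr scalerAl.
rewrite (exchange_big_dep xpredT) //= big_seq [RHS]big_seq.
apply: eq_bigr => l; rewrite mem_partitions => /andP[_ /andP[l_gt0 l_le]].
have lt_n : (n - sumn l < n)%N by rewrite ltn_subrL l_gt0.
rewrite (big_pred1 (Ordinal lt_n)) // => j /=.
rewrite -val_eqE /=; apply/eqP/eqP => [->|->]; rewrite subKn //.
exact: ltnW.
Qed.

End OverField.

(** * Clearing denominators *)

Section CommonDenominator.
Variable D : idomainType.

Lemma tofrac_numden (a : {fraction D}) :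
  exists2 d : D, d != 0 & exists c : D, tofrac d * a = tofrac c.
Proof.
elim/quotW: a => a; exists \d_a; first exact: denom_ratioP.
exists \n_a; rewrite !piE /=; apply/eqmodP => /=.
rewrite FracField.equivfE /FracField.mulf !numden_Ratio ?mul1r
  ?mulf_neq0 ?denom_ratioP ?oner_eq0 //.
by rewrite mulr1.
Qed.

Lemma common_denominator (T : eqType) (s : seq T) (a : T -> {fraction D}) :
  exists2 d : D, d != 0 & exists c : T -> D,
    forall t, t \in s -> tofrac (c t) = tofrac d * a t.
Proof.
elim: s => [|t s [d d_neq0 [c cE]]].
  by exists 1; rewrite ?oner_eq0 //; exists (fun=> 0).
have [e e_neq0 [b bE]] := tofrac_numden (a t).
exists (e * d); first by rewrite mulf_neq0.
exists (fun u => if u == t then d * b else e * c u) => u.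
rewrite inE; case: eqP => [-> _ | _ /= s_u]; rewrite !tofracM.
  by rewrite -bE; ring.
by rewrite cE // mulrA.
Qed.

End CommonDenominator.

(** * Generic weights *)

(** The polynomials in the x_i with coefficients in F[d_1, ..., d_k] and in
    its fraction field are [{mpoly D[k]}] and [{mpoly K[k]}]. *)
Section Transfer.
Variables (F : fieldType) (k : nat).
Local Notation D := {mpoly F[k]}.
Local Notation K := {fraction D}.

(** Independent indeterminates satisfy the hypothesis on subset sums in
    every characteristic, since no index repeats. *)
Lemma sum_var_neq0 (A : seq 'I_k) : uniq A -> A != [::] ->
  \sum_(i <- A) tofrac ('X_i : D) != 0.
Proof.
case: A => // i A /andP[iA _] _; rewrite -rmorph_sum tofrac_eq0 /=.
apply/eqP => /(congr1 (mcoeff U_(i)))/eqP.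
rewrite mcoeff0 linear_sum big_cons /= big_seq big1 => [|j A_j].
  by rewrite addr0 mcoeffX eqxx oner_eq0.
rewrite mcoeffX; case: eqP => // /(congr1 (fun m : 'X_{1..k} => m i)).
by rewrite !mnm1E eqxx; case: eqP => // ji; rewrite -ji A_j in iA.
Qed.

HB.instance Definition _ := GRing.RMorphism.copy (@dpoly F k)
  (comp_mpoly [tuple dvar F i | i < k]).

Lemma dpolyU i : dpoly ('X_i : D) = dvar F i.
Proof. by rewrite /dpoly comp_mpolyXU -tnth_nth tnth_mktuple. Qed.

(** The relation over the fraction field, multiplied by a common denominator of
    its coefficients, descends because extending scalars to the fraction field
    is injective on polynomials. *)
Lemma relation_over_polynomials :
  exists (n : nat) (an : D) (alpha : seq nat -> D), [/\ (1 <= n)%N, an != 0 &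
    forall i : 'I_k, an *: 'X_i ^+ n = \sum_(l <- partitions n)
      alpha l *: ((\prod_(j <- l) \sum_(r < k) ('X_r : D) *: 'X_r ^+ j)
        * 'X_i ^+ (n - sumn l)) :> {mpoly D[k]}].
Proof.
have [n [a [n_gt0 aE]]] := homogeneous_integral_relation sum_var_neq0.
have [d d_neq0 [c cE]] := common_denominator (partitions n) a.
exists n, d, c; split=> // i.
have map_inj : injective (map_mpoly (@tofrac D) : {mpoly D[k]} -> {mpoly K[k]}).
  move=> f g /mpolyP fg; apply/mpolyP => m; apply/eqP.
  by rewrite -tofrac_eq -!mcoeff_map_mpoly fg.
apply: map_inj; rewrite rmorph_sum /= map_mpolyZ rmorphXn /= map_mpolyX aE.
rewrite scaler_sumr big_seq [RHS]big_seq; apply: eq_bigr => l l_n.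
rewrite map_mpolyZ scalerA -cE // rmorphM rmorphXn /= map_mpolyX.
congr (_ *: (_ * _)); rewrite /psum_part rmorph_prod; apply: eq_bigr => j _.
rewrite rmorph_sum; apply: eq_bigr => r _.
by rewrite /= map_mpolyZ rmorphXn /= map_mpolyX.
Qed.

(** The identification of F[d][x] with F[d, x]. *)
Definition to_joint : {mpoly D[k]} -> {mpoly F[k + k]} :=
  mmap (@dpoly F k) (@xvar F k).

HB.instance Definition _ := GRing.RMorphism.copy to_joint
  (mmap (@dpoly F k) (@xvar F k)).

Lemma to_jointZ c f : to_joint (c *: f) = dpoly c * to_joint f.
Proof. exact: mmapZ. Qed.

Lemma to_jointU i : to_joint 'X_i = xvar F i.
Proof. by rewrite /to_joint mmapX mmap1U. Qed.

Lemma XmxX n : Xmx F k ^+ n = diag_mx (\row_i xvar F i ^+ n).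
Proof.
elim: n => [|n IHn].
  by rewrite expr0; apply/matrixP => i j; rewrite !mxE.
rewrite exprSr IHn; apply/matrixP => i j.
by rewrite [_ * _]mul_diag_mx !mxE exprSr mulrnAr.
Qed.

End Transfer.

Theorem mainTheorem1 (F : fieldType) (k : nat) (hk : (1 <= k)%N) :
  exists (n : nat) (an : {mpoly F[k]}) (alpha : seq nat -> {mpoly F[k]}),
    [/\ (1 <= n)%N,
        an != 0 &
        dpoly an *: Xmx F k ^+ n =
        \sum_(l <- partitions n)
           (dpoly (alpha l) * powsum_part F k l) *: Xmx F k ^+ (n - sumn l)].
Proof.
have [n [an [alpha [n_gt0 an_neq0 relE]]]] := relation_over_polynomials F k.
exists n, an, alpha; split=> //; rewrite XmxX -linearZ /=.
under eq_bigr => l _ do rewrite XmxX -linearZ /=.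
rewrite -linear_sum; congr diag_mx; apply/rowP => i.
rewrite summxE !mxE -to_jointU -rmorphXn -to_jointZ relE rmorph_sum.
apply: eq_bigr => l _; rewrite !mxE /= to_jointZ rmorphM rmorphXn /= to_jointU.
rewrite mulrA; congr (_ * _ * _); rewrite rmorph_prod; apply: eq_bigr => j _.
rewrite rmorph_sum; apply: eq_bigr => r _.
by rewrite /= to_jointZ rmorphXn /= to_jointU dpolyU.
Qed.
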